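(* Let $n\ge 3$ be an integer. The least positive integer $k(n)$ such that every $A_{k(n)}$-automaton with $n$ states is an $A_\omega$-automaton equals $\binom{n}{2}$.
   Context: A DFA $\mathcal{A}=(Q,\Sigma)$ consists of finite nonempty sets $Q$ (states) and $\Sigma$ (letters) with a map $Q\times\Sigma\to Q$, $(q,a)\mapsto q\cdot a$, extended to words by $q\cdot\varepsilon=q$, $q\cdot(wa)=(q\cdot w)\cdot a$, and to subsets by $P\cdot w=\{p\cdot w:p\in P\}$. A word $w$ is a reset word for $\mathcal{A}$ if $|Q\cdot w|=1$. For $k$ a positive integer or $k=\omega$, the $k$-game on $\mathcal{A}$: two players, Alice and Bob, alternate moves. On each of her turns Alice chooses a letter of $\Sigma$; on each of his turns Bob chooses a word over $\Sigma$ (possibly empty) of length less than $k$ if $k$ is an integer, and an arbitrary finite word if $k=\omega$. The history of the game up to a turn is the concatenation, in order, of all letters and words chosen so far. Alice wins if at some turn the history is a reset word for $\mathcal{A}$; Bob wins if the game continues forever. (It does not matter who moves first.) $\mathcal{A}$ is an $A_k$-automaton if Alice has a winning strategy in the $k$-game on $\mathcal{A}$. *)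

(* Defs.v *)
From mathcomp Require Import all_boot.

Set Implicit Arguments.
Unset Strict Implicit.
Unset Printing Implicit Defensive.

Record dfa := DFA {
  state : finType;
  letter : finType;
  step : state -> letter -> state;
  state_nonempty : 0 < #|state|;
  letter_nonempty : 0 < #|letter|
}.

Definition word (A : dfa) := seq (letter A).

Definition run (A : dfa) (q : state A) (w : word A) : state A :=
  foldl (@step A) q w.

Definition set_run (A : dfa) (P : {set state A}) (w : word A) : {set state A} :=
  [set run p w | p in P].

Definition reset_word (A : dfa) (w : word A) : Prop :=
  #|set_run [set: state A] w| = 1.

(* [Some k] is the integer parameter k, [None] is omega. *)
Definition bob_allowed (A : dfa) (k : option nat) (w : word A) : Prop :=
  if k is Some k' then size w < k' else True.

(* The word [p t] is the choice made at turn t. Alice moves first, so she moves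
   at even turns, by one-letter words, and Bob moves at odd turns. A play is
   kept infinite after Alice has won: this is harmless, since every extension
   of a reset word is a reset word. *)
Definition play (A : dfa) := nat -> word A.

(* The argument is the list of all choices made so far, by both players. *)
Definition strategy (A : dfa) := seq (word A) -> letter A.

Definition follows (A : dfa) (s : strategy A) (p : play A) : Prop :=
  forall i, p i.*2 = [:: s (mkseq p i.*2)].

Definition bob_legal (A : dfa) (k : option nat) (p : play A) : Prop :=
  forall i, bob_allowed k (p i.*2.+1).

Definition history (A : dfa) (p : play A) (t : nat) : word A :=
  flatten (mkseq p t).

Definition alice_wins (A : dfa) (p : play A) : Prop :=
  exists t, reset_word (history p t).

Definition winning (A : dfa) (k : option nat) (s : strategy A) : Prop :=
  forall p : play A, follows s p -> bob_legal k p -> alice_wins p.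

Definition is_A_automaton (k : option nat) (A : dfa) : Prop :=
  exists s : strategy A, winning k s.

Definition least_positive (P : nat -> Prop) (m : nat) : Prop :=
  [/\ 0 < m, P m & forall k, 0 < k -> P k -> m <= k].

(* Main.v *)
(* Only two-element sets matter: Alice wins from every set as soon as she wins
   from every pair, merging the tracked states two by two.

   Upper bound: if Bob wins the omega-game, let X be the set of pairs from which
   he does. Whatever Alice plays in X, he comes back to X by a shortest word,
   which visits each of the 'C(n, 2) pairs at most once; so words of length less
   than 'C(n, 2) are enough for him.

   Lower bound: fix a numbering of the pairs by heights 0, ..., 'C(n, 2) - 1 and
   take as letters all maps that do not merge the top pair and raise the height
   of a pair by at most 1. The maps onto the bottom pair that separate the top
   pair are letters; they merge every other pair, and send the top pair to the
   bottom one. So Bob must be able to go from the bottom to the top in one move: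
   he can when every height is one step away from the next, but this takes words
   of length 'C(n, 2) - 1. *)
Require Import Defs.
From mathcomp Require Import all_boot.
From mathcomp Require Import zify.
From Stdlib Require Import ClassicalEpsilon.

Set Implicit Arguments.
Unset Strict Implicit.
Unset Printing Implicit Defensive.

(** * The game played on sets of tracked states *)

Section PositionalGame.

Variable A : dfa.
Implicit Types (k : option nat) (P R : {set state A}) (w : word A).

Lemma set_run0 P : set_run P [::] = P.
Proof. by rewrite /set_run /run /= imset_id. Qed.

Lemma set_run_cat P w1 w2 : set_run P (w1 ++ w2) = set_run (set_run P w1) w2.
Proof.
rewrite /set_run -imset_comp; apply: eq_imset => x /=.
by rewrite /run foldl_cat.
Qed.

Lemma set_run2 x y w : set_run [set x; y] w = [set run x w; run y w].
Proof. by rewrite /set_run imsetU1 imset_set1. Qed.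

Lemma set_run2_cons x y a w :
  set_run [set x; y] (a :: w) = set_run [set step x a; step y a] w.
Proof. by rewrite !set_run2. Qed.

Lemma card_set_run_cat P w1 w2 : #|set_run P (w1 ++ w2)| <= #|set_run P w1|.
Proof. by rewrite set_run_cat; apply: leq_imset_card. Qed.

(* Alice, to move, wins the game in which only the states of P are tracked. *)
Inductive alice_wins_from k : {set state A} -> Prop :=
| Wins_small P : #|P| <= 1 -> alice_wins_from k P
| Wins_move P a :
    (forall w, bob_allowed k w -> alice_wins_from k (set_run P (a :: w))) ->
    alice_wins_from k P.

Lemma alice_wins_from_sub k P R :
  alice_wins_from k P -> R \subset P -> alice_wins_from k R.
Proof.
move=> win; elim: win R => {P} [P P1|P a _ IH] R RP.
  by apply: Wins_small; apply: leq_trans P1; apply: subset_leq_card.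
by apply: (Wins_move (a := a)) => w /IH; apply; apply: imsetS.
Qed.

Lemma alice_wins_from_pairs k :
  (forall P, #|P| <= 2 -> alice_wins_from k P) ->
  forall P, alice_wins_from k P.
Proof.
move=> winP P; move: {2}#|P| (leqnn #|P|) => N; elim: N P => [|N IH] P PN.
  by apply: winP; apply: leq_trans PN _.
have [|P2] := leqP #|P| 2; first exact: winP.
(* While Alice plays for [P0], the other tracked states never grow in number; once [P0] has shrunk
   to at most one state, the union has size at most [N]. *)
have winU P0 R : alice_wins_from k P0 -> #|R| < N -> alice_wins_from k (P0 :|: R).
  move=> win; elim: win R => {}P0 => [P1|a _ IHa] R RN.
    by apply: IH; rewrite cardsU; lia.
  apply: (Wins_move (a := a)) => w /IHa /(_ (set_run R (a :: w))).
  by rewrite /set_run imsetU; apply; apply: leq_ltn_trans RN; apply: leq_imset_card.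
have /card_gt1P[x [y [xP yP xy]]] : 1 < #|P| by apply: ltnW.
have sP : [set x; y] \subset P by rewrite subUset !sub1set xP.
rewrite -(setID P [set x; y]) (setIidPr sP); apply: winU.
  by apply: winP; rewrite cards2 xy.
by rewrite cardsD (setIidPr sP) cards2 xy; lia.
Qed.

Lemma mkseq_add2 (p : play A) i :
  mkseq p i.+1.*2 = mkseq p i.*2 ++ [:: p i.*2; p i.*2.+1].
Proof. by rewrite doubleS !mkseqS -!cats1 -catA. Qed.

Lemma mkseq_shift2 (p : play A) i :
  mkseq p i.+2 = [:: p 0, p 1 & mkseq (fun j => p j.+2) i].
Proof.
by rewrite /mkseq /= -[2]/(2 + 0) iotaDl -map_comp.
Qed.

Lemma alice_wins_from_strategy k P :
  alice_wins_from k P ->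
  exists s : strategy A, forall p : play A, follows s p -> bob_legal k p ->
    exists t, #|set_run P (history p t)| <= 1.
Proof.
elim=> {P} [P P1|P a _ IH].
  have /card_gt0P[a _] := letter_nonempty A.
  by exists (fun=> a) => p _ _; exists 0; rewrite set_run0.
have [s sP] : exists s : word A -> strategy A, forall w, bob_allowed k w ->
    forall p, follows (s w) p -> bob_legal k p ->
    exists t, #|set_run (set_run P (a :: w)) (history p t)| <= 1.
  suff H w : exists s : strategy A, bob_allowed k w ->
      forall p, follows s p -> bob_legal k p ->
      exists t, #|set_run (set_run P (a :: w)) (history p t)| <= 1.
    exists (fun w => proj1_sig (constructive_indefinite_description _ (H w))).
    by move=> w; exact: (proj2_sig (constructive_indefinite_description _ (H w))).
  have [kw|nkw] := classic (bob_allowed k w); last by exists (fun=> a) => /nkw.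
  by have [s sP] := IH w kw; exists s.
(* After [a], Alice reads Bob's first answer in the history and follows the strategy chosen for it
   on the rest. The default serves the empty history, the only one with fewer than two choices at
   her turns. *)
exists (fun h => if h is _ :: w :: h' then s w h' else a) => p sp kp.
have p0 : p 0 = [:: a] by rewrite (sp 0).
have [|i|t Pt] := sP _ (kp 0) (fun j => p j.+2).
- by move=> i; have := sp i.+1; rewrite doubleS mkseq_shift2.
- exact: (kp i.+1).
exists t.+2; rewrite /history mkseq_shift2 /= p0 /=.
by rewrite -cat_cons set_run_cat.
Qed.

Lemma alice_wins_from_setT k : alice_wins_from k setT -> is_A_automaton k A.
Proof.
case/alice_wins_from_strategy=> s sP; exists s => p sp kp.
have [t t1] := sP p sp kp; exists t; apply/eqP; rewrite eqn_leq t1 card_gt0.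
have /card_gt0P[x _] := state_nonempty A.
by apply/set0Pn; exists (run x (history p t)); apply: imset_f; rewrite inE.
Qed.

(** By contradiction: from a set that Alice does not win, every letter has a legal answer leading to
    another such set. These answers, played against [s], keep the tracked set lost forever. *)
Lemma is_A_automaton_wins_from k P : is_A_automaton k A -> alice_wins_from k P.
Proof.
move=> [s win]; apply: alice_wins_from_sub (subsetT P).
apply: NNPP => lose.
have [b bP] : exists b : {set state A} -> letter A -> word A,
    forall P a, ~ alice_wins_from k P ->
    bob_allowed k (b P a) /\ ~ alice_wins_from k (set_run P (a :: b P a)).
  suff H Q a : exists w, ~ alice_wins_from k Q ->
      bob_allowed k w /\ ~ alice_wins_from k (set_run Q (a :: w)).
    exists (fun Q a => proj1_sig (constructive_indefinite_description _ (H Q a))).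
    by move=> Q a; exact: (proj2_sig (constructive_indefinite_description _ (H Q a))).
  have [wQ|lQ] := classic (alice_wins_from k Q); first by exists [::].
  apply: NNPP => noW; apply: lQ; apply: (Wins_move (a := a)) => w kw.
  by apply: NNPP => lw; apply: noW; exists w.
pose bob (h : seq (word A)) := b (set_run setT (flatten h)) (s h).
pose H i := iter i (fun h : seq (word A) => h ++ [:: [:: s h]; bob h]) [::].
pose p : play A := fun t => if odd t then bob (H t./2) else [:: s (H t./2)].
have pe i : p i.*2 = [:: s (H i)] by rewrite /p odd_double doubleK.
have po i : p i.*2.+1 = bob (H i).
  by rewrite /p /= odd_double /= uphalf_double.
have pH i : mkseq p i.*2 = H i.
  by elim: i => // i IH; rewrite mkseq_add2 IH pe po.
have loseH i : ~ alice_wins_from k (set_run setT (flatten (H i))).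
  elim: i => [|i IH]; first by rewrite set_run0.
  by rewrite /= flatten_cat set_run_cat /= cats0; case: (bP _ (s (H i)) IH).
have [|i|t t1] := win p.
- by move=> i; rewrite pe pH.
- by rewrite po; case: (bP _ (s (H i)) (loseH i)).
(* A reset at turn [t] persists to turn [t.*2], a round boundary, where [loseH] applies. *)
apply: (loseH t); apply: Wins_small; rewrite -pH -[t.*2]addnn.
have -> : mkseq p (t + t) = mkseq p t ++ mkseq (fun i => p (t + i)) t.
  have := iotaDl t 0 t; rewrite addn0 => iota_t.
  by rewrite /mkseq iotaD map_cat iota_t -map_comp.
rewrite flatten_cat; apply: leq_trans (card_set_run_cat _ _ _) _.
by rewrite /reset_word /history in t1; rewrite t1.
Qed.

(* A shortest such word visits pairwise distinct two-element sets. *)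
Lemma pair_short_word (X : {set state A} -> Prop) P w :
  (forall R, #|R| <= 1 -> ~ X R) -> #|P| <= 2 -> X (set_run P w) ->
  exists2 w', size w' < 'C(#|state A|, 2) & X (set_run P w').
Proof.
move=> X1 P2; elim: {w}_.+1 {-2}w (ltnSn (size w)) => // N IH w wN Xw.
pose f (i : 'I_(size w).+1) := set_run P (take i w).
have [injf|/injectivePn[i [j ij fij]]] := boolP (injectiveb f).
  (* The [size w + 1] prefixes, the empty one included, give distinct two-element sets, hence the
     strict bound. *)
  exists w => //; rewrite -card_draws -[in X in X <= _](card_ord (size w).+1).
  rewrite -(card_codom (injectiveP _ injf)); apply: subset_leq_card.
  apply/subsetP=> _ /codomP[i ->]; rewrite inE eqn_leq.
  apply/andP; split; first exact: leq_trans (leq_imset_card _ _) P2.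
  rewrite ltnNge; apply/negP=> fi1; apply: (X1 (set_run P w)) => //.
  by rewrite -(cat_take_drop i w); apply: leq_trans (card_set_run_cat _ _ _) fi1.
wlog lij : i j ij fij / i < j.
  move=> H; have [lij|lji|/val_inj ji] := ltngtP i j; first exact: (H i j).
  - by apply: (H j i) => //; rewrite eq_sym.
  - by rewrite ji eqxx in ij.
have jw : j <= size w by rewrite -ltnS.
(* Two prefixes with the same image enclose a loop, which is cut out. *)
apply: (IH (take i w ++ drop j w)).
  by rewrite size_cat size_drop size_takel; lia.
by rewrite set_run_cat [set_run P _]fij -set_run_cat cat_take_drop.
Qed.

Lemma alice_wins_from_binomial P :
  #|P| <= 2 -> alice_wins_from (Some 'C(#|state A|, 2)) P ->
  alice_wins_from None P.
Proof.
move=> P2 win; elim: win P2 => {}P => [P1 _|a _ IH P2]; first exact: Wins_small.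
have le2 w : #|set_run P w| <= 2 by apply: leq_trans (leq_imset_card _ _) P2.
apply: (Wins_move (a := a)) => w _; apply: NNPP => lose.
have [R R1 lR| | |w' kw'] :=
    @pair_short_word (fun R => ~ alice_wins_from None R) (set_run P [:: a]) w.
- by apply: lR; apply: Wins_small.
- exact: le2.
- by rewrite -set_run_cat.
by rewrite -set_run_cat; apply; exact: IH.
Qed.

End PositionalGame.


(* The numbering comes from Cerny's automaton, with letters q |-> q + 1 (mod n)
   and n - 1 |-> 0. A pair {t - d, t}, with t mod n and cyclic distance d, has
   height (d - 1) * n + t; when d = n / 2, t is the smaller element. A shortest
   path from {0, n - 1} to {n.-1./2, n - 1} rotates through all the pairs at a
   given distance and then uses the second letter to increase d by one. *)
Definition height_lt n x y :=
  if (y - x).*2 < n then (y - x).-1 * n + y else (n - (y - x)).-1 * n + x.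

Definition height n x y := height_lt n (minn x y) (maxn x y).

Lemma heightC n x y : height n x y = height n y x.
Proof. by rewrite /height minnC maxnC. Qed.

Lemma height_ltE n x y : x < y -> height n x y = height_lt n x y.
Proof. by move=> /ltnW xy; rewrite /height (minn_idPl xy) (maxn_idPr xy). Qed.

Lemma height_bound n x y : x < y < n -> height_lt n x y < n * n.
Proof.
move=> /andP[xy yn]; rewrite /height_lt; case: ifP => h.
  apply: (@leq_trans ((y - x).-1.+1 * n)); first by rewrite mulSn; lia.
  by rewrite leq_mul2r; lia.
apply: (@leq_trans ((n - (y - x)).-1.+1 * n)); first by rewrite mulSn; lia.
by rewrite leq_mul2r; lia.
Qed.

Lemma height_lt_rot n x y : height_lt n x.+1 y.+1 = (height_lt n x y).+1.
Proof. by rewrite /height_lt subSS; case: ifP => _; rewrite addnS. Qed.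

(** Rotation sends [{x, N}] to [{0, x + 1}] and keeps the cyclic distance. If [t] is [x] and the
    distance is not half of [N.+1], then [t] grows by one; otherwise [t] falls back to 0. *)
Lemma height_lt_wrap N x : x < N ->
  height_lt N.+1 0 x.+1 <= (height_lt N.+1 x N).+1 ?= iff (N.+1 < (N - x).*2).
Proof.
move=> xN; apply/leqifP; rewrite /height_lt subn0.
have -> : N.+1 - x.+1 = N - x by lia.
have [lt_d|le_d] := ltnP N.+1 (N - x).*2.
  rewrite ifT; last lia; rewrite ifF; last lia.
  have -> : (N.+1 - (N - x)).-1 = x by lia.
  by rewrite addnS.
rewrite ifF; last lia; rewrite addn0.
have [lt_d2|le_d2] := ltnP (N - x).*2 N.+1; first by rewrite ltnS leq_addr.
have -> : (N.+1 - (N - x)).-1 = (N - x).-1 by lia.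
by rewrite ltnS leq_addr.
Qed.

(** The second letter sends [{x, N}] to [{0, x}]. If [N < x.*2], the distance grows by one while [t]
    drops from [N] to 0, a single step of height; otherwise the height falls. *)
Lemma height_lt_shift N x : 0 < x < N ->
  height_lt N.+1 0 x <= (height_lt N.+1 x N).+1 ?= iff (N < x.*2).
Proof.
move=> /andP[x0 xN]; apply/leqifP; rewrite /height_lt subn0 addn0.
have [lt_d|le_d] := ltnP N x.*2.
  rewrite ifF; last lia; rewrite ifT; last lia.
  have -> : N.+1 - x = (N - x).-1.+2 by lia.
  by rewrite /= mulSn; apply/eqP; lia.
rewrite ifT; last lia; have [lt_d2|le_d2] := ltnP (N - x).*2 N.+1.
  have -> : N - x = x by lia.
  by lia.
have -> : (N.+1 - (N - x)).-1 = x by lia.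
have : x.-1 * N.+1 <= x * N.+1 by rewrite leq_mul2r leq_pred orbT.
by lia.
Qed.

(** Each distance fills a block of [N.+1] heights, except that for odd [N] the largest distance
    fills only half a block, ending at [t = N./2]. *)
Lemma height_lt_top N : 1 < N -> (height_lt N.+1 N./2 N).+1 = 'C(N.+1, 2).
Proof.
move=> N1; rewrite bin2 /= /height_lt; have := odd_double_half N.
case: (odd N) => /= N2.
  have -> : N - N./2 = N./2.+1 by lia.
  rewrite ifF; last lia.
  have -> : (N.+1 - N./2.+1).-1 = N./2 by lia.
  by nia.
have -> : N - N./2 = N./2 by lia.
rewrite ifT; last lia.
have [m Nm] : exists m, N./2 = m.+1 by exists N./2.-1; lia.
by nia.
Qed.

Lemma height_lt_bottom N : 0 < N -> height_lt N.+1 0 N = 0.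
Proof. by move=> N0; rewrite /height_lt subn0 subSnn ifF //; lia. Qed.

(** * The automaton on which Bob needs long words *)

Section SlowAutomaton.

Variable N : nat.
Hypothesis N1 : 1 < N.
Let Q := 'I_N.+1.

Definition mid : Q := inord N./2.

Lemma val_mid : mid = N./2 :> nat.
Proof. by rewrite inordK //; lia. Qed.

Definition gentle (f : {ffun Q -> Q}) :=
  (f mid != f ord_max) &&
  [forall x, forall y, (f x != f y) ==>
     (height N.+1 (f x) (f y) <= (height N.+1 x y).+1)].

Lemma gentleP (f : Q -> Q) :
  f mid != f ord_max ->
  (forall x y : Q, x < y -> f x != f y ->
     height N.+1 (f x) (f y) <= (height_lt N.+1 x y).+1) ->
  gentle (finfun f).
Proof.
move=> fmid fH; rewrite /gentle !ffunE fmid /=.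
apply/forallP=> x; apply/forallP=> y; apply/implyP; rewrite !ffunE => fxy.
have [xy|yx|/val_inj xy] := ltngtP x y.
- by rewrite [X in _ <= X.+1]height_ltE //; apply: fH.
- rewrite heightC [X in _ <= X.+1]heightC [X in _ <= X.+1]height_ltE //.
  by apply: fH => //; rewrite eq_sym.
- by rewrite xy eqxx in fxy.
Qed.

Lemma ltn_max (x : Q) : x != ord_max -> x < N.
Proof. by rewrite -val_eqE /= => xN; have := ltn_ord x; lia. Qed.

Lemma mid_neq_max : mid != ord_max.
Proof. by rewrite -val_eqE /= val_mid; lia. Qed.

Definition rot_map (x : Q) : Q := if x == ord_max then ord0 else inord x.+1.

Definition shift_map (x : Q) : Q := if x == ord_max then ord0 else x.

Definition fold_map (S : pred Q) (x : Q) : Q := if S x then ord0 else ord_max.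

Lemma height_rot (x y : Q) : x < y ->
  height N.+1 (rot_map x) (rot_map y) <= (height_lt N.+1 x y).+1
    ?= iff (y < N) || (N.+1 < (N - x).*2).
Proof.
move=> xy; have xN : x < N by have := ltn_ord y; lia.
have -> : rot_map x = inord x.+1.
  by rewrite /rot_map ifF // -val_eqE /=; lia.
rewrite /rot_map; case: eqP => [->|/eqP/ltn_max yN].
  rewrite ltnn heightC inordK ?height_ltE //=.
  exact: height_lt_wrap.
by rewrite yN !inordK // height_ltE // height_lt_rot; split; rewrite ?eqxx.
Qed.

Lemma height_shift (x y : Q) : x < y -> shift_map x != shift_map y ->
  height N.+1 (shift_map x) (shift_map y) <= (height_lt N.+1 x y).+1.
Proof.
move=> xy; have xN : x < N by have := ltn_ord y; lia.
have -> : shift_map x = x by rewrite /shift_map ifF // -val_eqE /=; lia.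
rewrite /shift_map; case: (eqVneq y ord_max) => [->|_ _]; last by rewrite height_ltE.
rewrite -val_eqE /= => x0; rewrite heightC height_ltE ?lt0n //.
by apply: (height_lt_shift _).1; rewrite lt0n x0.
Qed.

Lemma gentle_id : gentle (finfun id).
Proof. by apply: gentleP mid_neq_max _ => x y xy _; rewrite height_ltE. Qed.

Lemma gentle_rot : gentle (finfun rot_map).
Proof.
apply: gentleP => [|x y xy _]; last exact: height_rot.
rewrite /rot_map eqxx (negPf mid_neq_max) -val_eqE /= inordK // val_mid; lia.
Qed.

Lemma gentle_shift : gentle (finfun shift_map).
Proof.
apply: gentleP height_shift.
by rewrite /shift_map eqxx (negPf mid_neq_max) -val_eqE /= val_mid; lia.
Qed.

Lemma height_bottom : height N.+1 (ord0 : Q) (ord_max : Q) = 0.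
Proof. by rewrite height_ltE /= ?height_lt_bottom; lia. Qed.

Lemma height_set2 (x y u v : Q) : x != y -> [set x; y] = [set u; v] ->
  height N.+1 x y = height N.+1 u v.
Proof.
move=> nxy /setP E; move: (E x) (E y); rewrite !inE !eqxx orbT /=.
move=> /esym/orP[]/eqP xu /esym/orP[]/eqP yv; move: nxy; rewrite xu yv ?eqxx //.
by rewrite heightC.
Qed.

(** A pair that is not merged lands at height 0, so the height condition is automatic. *)
Lemma gentle_fold (S : pred Q) : S mid != S ord_max -> gentle (finfun (fold_map S)).
Proof.
move=> SL; apply: gentleP => [|x y xy].
  by move: SL; rewrite /fold_map; do 2!case: (S _) => //; rewrite -val_eqE /=; lia.
by rewrite /fold_map; do 2!case: (S _); rewrite ?eqxx // ?height_bottom // heightC height_bottom.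
Qed.

Definition gentle_letter f (gf : gentle f) : {f : {ffun Q -> Q} | gentle f} :=
  exist _ f gf.

Definition slow_step (q : Q) (f : {f : {ffun Q -> Q} | gentle f}) : Q := val f q.

Lemma slow_state_nonempty : 0 < #|Q|.
Proof. by rewrite card_ord. Qed.

Lemma slow_letter_nonempty : 0 < #|{: {f : {ffun Q -> Q} | gentle f}}|.
Proof. by apply/card_gt0P; exists (gentle_letter gentle_id). Qed.

Definition slow_dfa : dfa :=
  DFA slow_step slow_state_nonempty slow_letter_nonempty.

Definition top_pair : {set state slow_dfa} := [set mid; ord_max].

Lemma card_top_pair : #|top_pair| = 2.
Proof. by rewrite cards2 mid_neq_max. Qed.

Lemma height_top : (height N.+1 mid (ord_max : Q)).+1 = 'C(N.+1, 2).
Proof. by rewrite height_ltE /= val_mid ?height_lt_top //; lia. Qed.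

Lemma height_run (x y : state slow_dfa) (w : word slow_dfa) :
  run x w != run y w ->
  height N.+1 (run x w) (run y w) <= height N.+1 x y + size w.
Proof.
elim: w x y => [|[f gf] w IH] x y; first by rewrite addn0.
move=> xyw; apply: leq_trans (IH _ _ xyw) _; rewrite /= addnS -addSn leq_add2r.
have /andP[_ /forallP/(_ x)/forallP/(_ y)/implyP] := gf; apply.
by apply: contraNneq xyw => fxy; rewrite /run /= /slow_step /= fxy.
Qed.

(** Rotation climbs until [t] would wrap around to 0; there the second letter passes to the next
    distance, except at the top. *)
Lemma climb (x y : state slow_dfa) : x != y -> [set x; y] != top_pair ->
  exists a : letter slow_dfa, step x a != step y a /\
    height N.+1 (step x a) (step y a) = (height N.+1 x y).+1.
Proof.
wlog xy : x y / (x < y)%N.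
  move=> H nxy nT; have [xy|yx|/val_inj xy] := ltngtP x y; first exact: H.
  - have [||a [na ha]] := H y x yx.
    + by rewrite eq_sym.
    + by rewrite setUC.
    by exists a; rewrite eq_sym heightC ha heightC.
  - by rewrite xy eqxx in nxy.
move=> nxy nT; have xN : x < N by have := ltn_ord y; lia.
have [rise|] := boolP ((y < N) || (N.+1 < (N - x).*2)).
  exists (gentle_letter gentle_rot : letter slow_dfa); rewrite /= /slow_step /= !ffunE; split.
    have xm : (x == ord_max) = false by rewrite -val_eqE /=; lia.
    rewrite /rot_map xm; case: (eqVneq y ord_max) => [_|/ltn_max yN].
      by rewrite -val_eqE /= inordK.
    by rewrite -val_eqE /= !inordK // eqSS; lia.
  by rewrite [in RHS]height_ltE //; apply/eqP; rewrite (height_rot xy).2.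
rewrite negb_or -!leqNgt => /andP[yN xle].
have ym : y = ord_max by apply: val_inj => /=; have := ltn_ord y; lia.
(* [xle] gives [N./2 <= x], and equality would be the top pair. *)
have xmid : N < x.*2.
  suff : x != N./2 :> nat by lia.
  rewrite -val_mid; apply: contra_neq nT => /val_inj ->.
  by rewrite ym.
have xm : (x == ord_max) = false by rewrite -val_eqE /=; lia.
exists (gentle_letter gentle_shift : letter slow_dfa); rewrite /= /slow_step /= !ffunE.
rewrite /shift_map xm ym eqxx; split; first by rewrite -val_eqE /=; lia.
rewrite heightC !height_ltE //=; last lia.
by apply/eqP; rewrite (height_lt_shift _).2 //; lia.
Qed.

(** Heights are bounded and a climb can stop only at the top pair, so no bijection between pairs and
    heights is needed. *)
Lemma reach_top (x y : state slow_dfa) : x != y ->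
  exists w : word slow_dfa, set_run [set x; y] w = top_pair.
Proof.
move: {2}(_ - _) (leqnn (N.+1 * N.+1 - height N.+1 x y)) => b.
elim: b x y => [|b IH] x y hb nxy.
  suff : height N.+1 x y < N.+1 * N.+1 by lia.
  have [xy|yx|/val_inj xy] := ltngtP x y.
  - by rewrite height_ltE // height_bound // xy ltn_ord.
  - by rewrite heightC height_ltE // height_bound // yx ltn_ord.
  - by rewrite xy eqxx in nxy.
have [T|nT] := eqVneq [set x; y] top_pair; first by exists [::]; rewrite set_run0.
have [a [na ha]] := climb nxy nT.
have [|w wT] := IH (step x a) (step y a) _ na; first by rewrite ha; lia.
by exists (a :: w); rewrite set_run2_cons.
Qed.

Lemma top_not_wins P : alice_wins_from None P -> P <> top_pair.
Proof.
elim=> {}P => [P1|a _ IH] PT; first by rewrite PT card_top_pair in P1.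
have na : step (mid : state slow_dfa) a != step (ord_max : state slow_dfa) a.
  by case: (a) => f gf; have /andP[] := gf.
have [w wT] := reach_top na; apply: (IH w) => //.
by rewrite PT set_run2_cons.
Qed.

Lemma slow_dfa_not_omega : ~ is_A_automaton None slow_dfa.
Proof. by move=> /(is_A_automaton_wins_from top_pair)/top_not_wins. Qed.

(** Some element of the top pair lies outside [{x, y}]. Its indicator separates the top pair but not
    [x] from [y], so the fold along it is a letter that merges them. *)
Lemma non_top_wins k (x y : state slow_dfa) :
  [set x; y] != top_pair -> alice_wins_from k [set x; y].
Proof.
move=> nT; suff [S SL Sxy] : exists2 S : pred Q, S mid != S ord_max & S x = S y.
  apply: (Wins_move (a := gentle_letter (gentle_fold SL) : letter slow_dfa)) => w _; apply: Wins_small.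
  rewrite set_run2_cons /= /slow_step /= !ffunE /fold_map Sxy setUid.
  by rewrite /set_run imset_set1 cards1.
have sep z : z \in top_pair -> pred1 z mid != pred1 z ord_max.
  have nM := mid_neq_max; have nm := nM; rewrite eq_sym in nm.
  by rewrite !inE => /orP[]/eqP-> /=; rewrite eqxx ?(negPf nM) ?(negPf nm).
have [mP|mP] := boolP (mid \in [set x; y]); last first.
  exists (pred1 mid); first by apply: sep; rewrite set21.
  by move: mP; rewrite !inE /= negb_or !(eq_sym mid) => /andP[/negPf-> /negPf->].
have [MP|MP] := boolP ((ord_max : state slow_dfa) \in [set x; y]); last first.
  exists (pred1 ord_max); first by apply: sep; rewrite set22.
  by move: MP; rewrite !inE /= negb_or !(eq_sym ord_max) => /andP[/negPf-> /negPf->].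
case/negP: nT; rewrite eq_sym eqEcard subUset !sub1set mP MP card_top_pair.
by rewrite cards2; case: (x != y).
Qed.

Lemma slow_dfa_wins k : k < 'C(N.+1, 2) -> is_A_automaton (Some k) slow_dfa.
Proof.
move=> kN; apply: alice_wins_from_setT; apply: alice_wins_from_pairs => P P2.
have [P1|P1] := leqP #|P| 1; first exact: Wins_small.
have /cards2P[x [y [nxy ->]]] : #|P| == 2 by rewrite eqn_leq P2.
have [->|/non_top_wins//] := eqVneq [set x; y] top_pair.
have SL : pred1 (ord_max : Q) mid != pred1 (ord_max : Q) (ord_max : Q).
  by rewrite /= eqxx (negPf mid_neq_max).
(* Alice folds the top pair onto the bottom one, at height 0; Bob has at most ['C(N.+1, 2) - 2]
   letters, one too few to climb back. *)
set a : letter slow_dfa := gentle_letter (gentle_fold SL).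
apply: (Wins_move (a := a)) => w kw.
rewrite set_run2_cons set_run2; apply: non_top_wins; apply/eqP=> T.
have nxy' : run (step (mid : state slow_dfa) a) w != run (step (ord_max : state slow_dfa) a) w.
  by have := card_top_pair; rewrite -T cards2; case: (_ != _).
have := height_run nxy'; rewrite (height_set2 nxy' T).
have -> : height N.+1 (step (mid : state slow_dfa) a) (step (ord_max : state slow_dfa) a) = 0.
  rewrite /= /slow_step /= !ffunE /fold_map /= eqxx (negPf mid_neq_max).
  by rewrite heightC height_bottom.
by move: kw kN; rewrite -height_top /=; lia.
Qed.

End SlowAutomaton.

Theorem theorem5p2 (n : nat) (hn : 3 <= n) :
  least_positive
    (fun k => forall A : dfa, #|state A| = n ->
       is_A_automaton (Some k) A -> is_A_automaton None A)
    'C(n, 2).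
Proof.
split; first by rewrite bin_gt0; lia.
  move=> A An Ak; apply: alice_wins_from_setT; apply: alice_wins_from_pairs => P P2.
  apply: alice_wins_from_binomial P2 _; rewrite An.
  exact: is_A_automaton_wins_from.
case: n hn => // N N1 k _ kP; rewrite leqNgt; apply/negP=> kN.
apply: (@slow_dfa_not_omega N N1); apply: kP; last exact: slow_dfa_wins.
by rewrite card_ord.
Qed.
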